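(* If $\mathcal A_1$ and $\mathcal A_2$ are surjective operator ideals, then so is $\mathcal A_1\circ\mathcal A_2$.
   Context: Operator ideals are quasi-normed operator ideals $(\mathcal A,\alpha)$ between Banach spaces. Composition: $T\in\mathcal A_1\circ\mathcal A_2(X,Y)$ iff $T=U\circ V$ with $V\in\mathcal A_2(X,Z)$, $U\in\mathcal A_1(Z,Y)$ for some Banach space $Z$. Surjective hull: let $B_X$ be the closed unit ball of $X$ and $q_X:\ell_1(B_X)\to X$, $q_X((\lambda_b)_{b\in B_X})=\sum_b\lambda_b b$; then $T\in\mathcal A^{sur}(X,Y)$ iff $T\circ q_X\in\mathcal A(\ell_1(B_X),Y)$. $\mathcal A$ is surjective if $\mathcal A^{sur}=\mathcal A$. *)

(* Defs.v *)
From HB Require Import structures.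
From mathcomp Require Import all_boot all_order all_algebra complex.
From mathcomp Require Import all_classical all_reals all_analysis.
From mathcomp Require showcase.summability.
Set Implicit Arguments.
Unset Strict Implicit.
Unset Printing Implicit Defensive.
Import Order.TTheory GRing.Theory Num.Theory numFieldNormedType.Exports.
Local Open Scope classical_set_scope.
Local Open Scope ring_scope.

Variant scalar_kind := RealScalars | ComplexScalars.

Definition scalars (R : realType) (k : scalar_kind) : numFieldType :=
  match k with RealScalars => R | ComplexScalars => R[i] end.

Lemma complex_complete (R : realType) (F : set_system R[i]^o) :
  ProperFilter F -> cauchy F -> cvg F.
Proof.
move=> FF /cauchyP cF.
have reC (x : R) : 0 < x -> 0 < (x%:C)%C by rewrite ltcR.
have norm_le (z : R[i]) : `|z| <= ((`|complex.Re z| + `|complex.Im z|)%:C)%C.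
  rewrite normc_def lecR -[leRHS]ger0_norm ?addr_ge0// -sqrtr_sqr ler_wsqrtr//.
  by rewrite sqrrD !real_normK ?num_real// addrAC lerDl mulrn_wge0 ?mulr_ge0 ?normr_ge0.
have norm_ge (z : R[i]) :
    ((`|complex.Re z|)%:C)%C <= `|z| /\ ((`|complex.Im z|)%:C)%C <= `|z|.
  split; first exact: normc_ge_Re.
  rewrite normc_def lecR -[leLHS]sqrtr_sqr ler_wsqrtr//.
  by rewrite lerDr sqr_ge0.
have image_cvg (p : R[i] -> R) : (forall x y, p (x - y) = p x - p y) ->
    (forall z, ((`|p z|)%:C)%C <= `|z|) ->
    exists l : R, forall e, 0 < e -> F [set z | `|l - p z| < e].
  move=> pB pn; have : cvg ((p : R[i]^o -> R^o) @ F).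
    apply: R_complete; apply/cauchyP => e /reC e0.
    have [z Fz] := cF _ e0; exists (p z).
    have : F [set w : R[i] | `|p z - p w| < e]; last by rewrite -ball_normE.
    apply: filterS Fz => w; rewrite -ball_normE /= => zw.
    by rewrite -ltcR -pB; apply: le_lt_trans zw; exact: pn.
  move=> /cvg_ex[l /cvgrPdist_lt pl]; exists l => e e0.
  exact: pl.
have [a Fa] := image_cvg _ (fun x y : R[i] => raddfB (@complex.Re R) x y)
  (fun z => (norm_ge z).1).
have [b Fb] := image_cvg _ (fun x y : R[i] => raddfB (@complex.Im R) x y)
  (fun z => (norm_ge z).2).
apply/cvg_ex; exists (Complex a b : R[i]^o).
apply/(@cvgrPdist_lt R[i] R[i]^o) => e e0.
have : 0 < complex.Re e by move: e0; case: (e) => x y; rewrite ltcE /= => /andP[].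
move=> re0; have re2 : 0 < complex.Re e / 2 by rewrite divr_gt0.
apply: filterS (filterI (Fa _ re2) (Fb _ re2)) => -[x y] /= [ax yb].
apply: le_lt_trans (norm_le _) _ => /=.
have -> : e = ((complex.Re e)%:C)%C.
  by move: e0; case: (e) => u v; rewrite ltcE /= => /andP[/eqP-> _].
by rewrite ltcR /= [ltRHS]splitr ltrD.
Qed.

Section Scalars.
Variables (R : realType) (k : scalar_kind).

Definition scalar_re : scalars R k -> R :=
  match k return scalars R k -> R with
  | RealScalars => id
  | ComplexScalars => @complex.Re R
  end.

Definition scalar_of_real : R -> scalars R k :=
  match k return R -> scalars R k with
  | RealScalars => id
  | ComplexScalars => fun x => Complex x 0
  end.

Lemma scalar_of_realK : cancel scalar_of_real scalar_re.
Proof. by rewrite /scalar_of_real /scalar_re; case: k. Qed.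

Lemma scalar_reK z : 0 <= z -> scalar_of_real (scalar_re z) = z.
Proof.
rewrite /scalar_of_real /scalar_re; case: k z => //= -[x y].
by rewrite lecE /= => /andP[/eqP-> _].
Qed.

Lemma scalar_of_realD x y :
  scalar_of_real (x + y) = scalar_of_real x + scalar_of_real y.
Proof.
rewrite /scalar_of_real; case: k => //=.
by apply/eqP; rewrite eq_complex /= addr0 !eqxx.
Qed.

Lemma scalar_of_real0 : scalar_of_real 0 = 0.
Proof. by rewrite /scalar_of_real; case: k. Qed.

Lemma ler_scalar_of_real x y :
  (scalar_of_real x <= scalar_of_real y) = (x <= y).
Proof. by rewrite /scalar_of_real; case: k => //=; rewrite lecE /= eqxx. Qed.

Lemma scalars_complete (F : set_system (scalars R k)^o) :
  ProperFilter F -> cauchy F -> cvg F.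
Proof. by case: k F => F; [exact: R_complete | exact: complex_complete]. Qed.

End Scalars.

(* The scalar field as a one-dimensional Banach space.  It is an alias because the
   completeness instance of [_^o] is already taken by the real case. *)
Definition scalar_line (R : realType) (k : scalar_kind) : Type :=
  (scalars R k)^o.

HB.instance Definition _ R k :=
  NormedModule.copy (scalar_line R k) (scalars R k)^o.
HB.instance Definition _ R k :=
  Uniform_isComplete.Build (scalar_line R k) (@scalars_complete R k).

Section Ell1.
Variables (R : realType) (k : scalar_kind) (I : choiceType).
Local Notation K := (scalars R k).
Local Notation re := (@scalar_re R k).
Local Notation ofR := (@scalar_of_real R k).

(* The sum of the absolute values, possibly infinite. *)
Definition ell1_norm (f : I -> K) : \bar R :=
  \esum_(i in setT) (re `|f i|)%:E.

Definition ell1_pred : {pred I -> K^o} := fun f => `[< (ell1_norm f < +oo)%E >].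

Lemma scalar_re_le (x y : K) : 0 <= x -> x <= y -> re x <= re y.
Proof.
move=> x0 xy; rewrite -(@ler_scalar_of_real R k) !scalar_reK//.
exact: le_trans xy.
Qed.

Lemma scalar_re_ge0 (x : K) : 0 <= x -> 0 <= re x.
Proof. by move=> x0; rewrite -(@ler_scalar_of_real R k) scalar_of_real0 scalar_reK. Qed.

Lemma scalar_of_real_sum (s : seq I) (f : I -> R) :
  ofR (\sum_(i <- s) f i) = \sum_(i <- s) ofR (f i).
Proof. exact: (big_morph ofR (@scalar_of_realD R k) (@scalar_of_real0 R k)). Qed.

Lemma ell1_norm_le (f : I -> K) (M : K) :
  (forall s : seq I, uniq s -> \sum_(i <- s) `|f i| <= M) ->
  (ell1_norm f <= (re M)%:E)%E.
Proof.
move=> fM; apply: ge_ereal_sup => _ /= [A [Afin _] <-].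
rewrite fsbig_finite//= sumEFin lee_fin.
have sM := fM _ (finmap.fset_uniq (fset_set A)).
have M0 : 0 <= M by have := fM [::] isT; rewrite big_nil.
rewrite -(@ler_scalar_of_real R k) scalar_reK// scalar_of_real_sum.
by under eq_bigr => i _ do rewrite scalar_reK//.
Qed.

Lemma sum_le_ell1_norm (f : I -> K) (s : seq I) : uniq s ->
  f \in ell1_pred -> \sum_(i <- s) `|f i| <= ofR (fine (ell1_norm f)).
Proof.
move=> us /asboolP flt.
have fge0 : (0 <= ell1_norm f)%E.
  by apply: esum_ge0 => i _; rewrite lee_fin scalar_re_ge0.
have ffin : ell1_norm f \is a fin_num by rewrite ge0_fin_numE.
rewrite -(eq_bigr _ (fun i _ => scalar_reK (normr_ge0 (f i)))).
rewrite -scalar_of_real_sum ler_scalar_of_real -lee_fin fineK//.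
apply: ereal_sup_ubound; exists [set` s]; first by split.
by rewrite -fsbig_seq// sumEFin.
Qed.

Lemma ell1_pred_bound (f : I -> K) (M : K) :
  (forall s : seq I, uniq s -> \sum_(i <- s) `|f i| <= M) ->
  f \in ell1_pred /\ ofR (fine (ell1_norm f)) <= M.
Proof.
move=> fM; have fn := ell1_norm_le fM.
have fge0 : (0 <= ell1_norm f)%E.
  by apply: esum_ge0 => i _; rewrite lee_fin scalar_re_ge0.
have flt : (ell1_norm f < +oo)%E by apply: le_lt_trans fn (ltry _).
have M0 : 0 <= M by have := fM [::] isT; rewrite big_nil.
split; first exact/asboolP.
by rewrite -[leRHS]scalar_reK// ler_scalar_of_real -lee_fin fineK// ge0_fin_numE.
Qed.

Lemma ell1_submod : submod_closed ell1_pred.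
Proof.
split.
  by apply: (ell1_pred_bound (M := 0) _).1 => s _; rewrite big1// => i _; rewrite normr0.
move=> a f g fE gE.
apply: (ell1_pred_bound (M := `|a| * ofR (fine (ell1_norm f)) +
  ofR (fine (ell1_norm g))) _).1 => s us.
apply: le_trans (_ : _ <= \sum_(i <- s) (`|a| * `|f i| + `|g i|)) _.
  by apply: ler_sum => i _; rewrite -normrM; exact: ler_normD.
by rewrite big_split/= -mulr_sumr lerD// ?ler_wpM2l// sum_le_ell1_norm.
Qed.

HB.instance Definition _ := GRing.isSubmodClosed.Build K (I -> K^o) ell1_pred ell1_submod.

Record ell1 := Ell1 { ell1_fun :> I -> K^o ; _ : ell1_fun \in ell1_pred }.

HB.instance Definition _ := [isSub for ell1_fun].
HB.instance Definition _ := [Choice of ell1 by <:].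
HB.instance Definition _ := [SubChoice_isSubLmodule of ell1 by <:].

Definition ell1_normK (f : ell1) : K := ofR (fine (ell1_norm f)).

Lemma ell1_sum_le (f : ell1) (s : seq I) : uniq s ->
  \sum_(i <- s) `|f i| <= ell1_normK f.
Proof. by move=> us; apply: sum_le_ell1_norm => //; exact: valP f. Qed.

Lemma ell1_normK_le (f : ell1) M :
  (forall s : seq I, uniq s -> \sum_(i <- s) `|f i| <= M) -> ell1_normK f <= M.
Proof. by move=> fM; exact: (ell1_pred_bound fM).2. Qed.

Lemma ell1_normKD f g : ell1_normK (f + g) <= ell1_normK f + ell1_normK g.
Proof.
apply: ell1_normK_le => s us.
apply: le_trans (_ : _ <= \sum_(i <- s) (`|f i| + `|g i|)) _.
  by apply: ler_sum => i _; exact: ler_normD.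
by rewrite big_split/= lerD// ell1_sum_le.
Qed.

Lemma ell1_normKZ_le a f : ell1_normK (a *: f) <= `|a| * ell1_normK f.
Proof.
apply: ell1_normK_le => s us.
apply: le_trans (_ : _ <= \sum_(i <- s) (`|a| * `|f i|)) _.
  by apply: ler_sum => i _; rewrite -normrM.
by rewrite -mulr_sumr ler_wpM2l// ell1_sum_le.
Qed.

Lemma ell1_normKZ a f : ell1_normK (a *: f) = `|a| * ell1_normK f.
Proof.
apply/eqP; rewrite eq_le ell1_normKZ_le/=.
have [->|a0] := eqVneq a 0.
  rewrite normr0 mul0r; apply: le_trans (ell1_sum_le (0 *: f) (s := [::]) isT).
  by rewrite big_nil.
rewrite -ler_pdivlMl ?normr_gt0// -normfV.
by rewrite -[X in ell1_normK X <= _](scalerK a0) ell1_normKZ_le.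
Qed.

Lemma ell1_normK_eq0 f : ell1_normK f = 0 -> f = 0.
Proof.
move=> f0; apply/val_inj/funext => i /=; apply/eqP; rewrite -normr_le0.
by have := ell1_sum_le f (s := [:: i]) isT; rewrite big_seq1 f0.
Qed.

HB.instance Definition _ :=
  Lmodule_isNormed.Build K ell1 ell1_normKD ell1_normKZ ell1_normK_eq0.

Lemma ell1_normE (f : ell1) : `|f| = ofR (fine (ell1_norm f)).
Proof. by []. Qed.

Lemma ell1_complete (F : set_system ell1) :
  ProperFilter F -> cauchy F -> cvg F.
Proof.
move=> FF /cauchyP cF.
have coord_cvg i : exists l : K^o, forall e, 0 < e -> F [set f | `|l - f i| < e].
  have : cvg ((fun f : ell1 => f i) @ F).
    apply: scalars_complete; apply/cauchyP => e e0.
    have [f Ff] := cF _ e0; exists (f i).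
    have : F [set g : ell1 | `|f i - g i| < e]; last by rewrite -ball_normE.
    apply: filterS Ff => g; rewrite -ball_normE /= => fg; apply: le_lt_trans fg.
    by have := ell1_sum_le (f - g) (s := [:: i]) isT; rewrite big_seq1.
  by move=> /cvg_ex[l /cvgrPdist_lt pl]; exists l.
have [l Fl] := choice coord_cvg.
have sum_close (s : seq I) (e : K) : 0 < e ->
    F [set f : ell1 | \sum_(i <- s) `|l i - f i| < e].
  elim: s e => [|i s IH] e e0.
    by apply: filterS filterT => f _ /=; rewrite big_nil.
  have e2 : 0 < e / 2 by rewrite divr_gt0.
  apply: filterS (filterI (Fl i _ e2) (IH _ e2)) => f /= [fi fs].
  by rewrite big_cons [ltRHS]splitr ltrD.
have close (e : K) (f : ell1) s : uniq s -> 0 < e -> F (ball f e) ->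
    \sum_(i <- s) `|l i - f i| <= e + e.
  move=> us e0 fe.
  have [g [/= gl]] := filter_ex (filterI (sum_close s _ e0) fe).
  rewrite -ball_normE /= => fg.
  apply: le_trans (_ : _ <= \sum_(i <- s) (`|l i - g i| + `|(f - g) i|)) _.
    apply: ler_sum => i _.
    rewrite [X in `|X| <= _](_ : _ = (l i - g i) - (f - g) i).
      exact: ler_normB.
    by rewrite opprB /= [RHS]addrA subrK.
  rewrite big_split/= lerD ?(ltW gl)//.
  by apply: le_trans (ltW fg); exact: (ell1_sum_le (f - g)).
have lE : (l : I -> K^o) \in ell1_pred.
  have [f Ff] := cF 1 ltr01.
  apply: (ell1_pred_bound (M := 1 + 1 + `|f|) _).1 => s us.
  apply: le_trans (_ : _ <= \sum_(i <- s) (`|l i - f i| + `|f i|)) _.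
    by apply: ler_sum => i _; rewrite -[X in `|X| <= _](subrK (f i)) ler_normD.
  by rewrite big_split/= lerD ?close//; exact: ell1_sum_le.
apply/cvg_ex; exists (Ell1 lE); apply/cvgrPdist_le => e e0.
have e4 : 0 < e / 2 / 2 by rewrite !divr_gt0.
have [f Ff] := cF _ e4; apply: filterS (Ff) => g; rewrite -ball_normE /= => fg.
rewrite -[X in `|X| <= _](subrKA f) (le_trans (ler_normD _ _))//.
rewrite [leRHS]splitr lerD//; last first.
  by rewrite (le_trans (ltW fg))// ler_pdivrMr// ler_peMr ?ler1n// ltW// divr_gt0.
rewrite [leRHS]splitr; apply: (ell1_normK_le (f := Ell1 lE - f)) => s us.
exact: close.
Qed.

HB.instance Definition _ := Uniform_isComplete.Build ell1 ell1_complete.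

End Ell1.

Notation banachType R k := (completeNormedModType (scalars R k)).

Section OperatorIdeals.
Variables (R : realType) (k : scalar_kind).
Local Notation K := (scalars R k).

(* Norms of elements of a space over K take their values in K; this is the same
   number seen in R. *)
Definition real_norm (X : banachType R k) (x : X) : R := scalar_re `|x|.

Definition bounded_operator (X Y : banachType R k) (T : X -> Y) : Prop :=
  linear T /\ continuous T.

Definition operator_norm (X Y : banachType R k) (T : X -> Y) : R :=
  sup [set real_norm (T x) | x in [set x : X | `|x| <= 1]].

Definition operator_class := forall X Y : banachType R k, set (X -> Y).

(* Only the values at members of the class under consideration matter. *)
Definition operator_gauge := forall X Y : banachType R k, (X -> Y) -> R.

Record quasi_normed_operator_ideal (A : operator_class)
    (alpha : operator_gauge) : Prop := {
  ideal_bounded : forall X Y T, A X Y T -> bounded_operator T ;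
  ideal_id : A (scalar_line R k) (scalar_line R k) idfun ;
  ideal_add : forall X Y S T, A X Y S -> A X Y T -> A X Y (S \+ T) ;
  ideal_comp : forall (X0 X Y Y0 : banachType R k)
      (V : X0 -> X) (T : X -> Y) (U : Y -> Y0),
    bounded_operator V -> A X Y T -> bounded_operator U ->
    A X0 Y0 (U \o T \o V) ;
  gauge_ge0 : forall X Y T, A X Y T -> 0 <= alpha X Y T ;
  gauge_eq0 : forall X Y T, A X Y T -> alpha X Y T = 0 -> forall x, T x = 0 ;
  gauge_scale : forall X Y T (c : K), A X Y T ->
    alpha X Y (fun x => c *: T x) = scalar_re `|c| * alpha X Y T ;
  gauge_add : exists2 kappa : R, 1 <= kappa & forall X Y S T,
    A X Y S -> A X Y T ->
    alpha X Y (S \+ T) <= kappa * (alpha X Y S + alpha X Y T) ;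
  gauge_id : alpha (scalar_line R k) (scalar_line R k) idfun = 1 ;
  gauge_comp : forall (X0 X Y Y0 : banachType R k)
      (V : X0 -> X) (T : X -> Y) (U : Y -> Y0),
    bounded_operator V -> A X Y T -> bounded_operator U ->
    alpha X0 Y0 (U \o T \o V) <=
      operator_norm U * alpha X Y T * operator_norm V ;
  (* By Hahn-Banach this follows from [gauge_scale], [gauge_id] and [gauge_comp]
     (compose T with c |-> c *: x on the right and a functional on the left), so
     it does not restrict the notion. *)
  gauge_norm : forall X Y T, A X Y T -> operator_norm T <= alpha X Y T
}.

Definition ideal_composition (A1 A2 : operator_class) : operator_class :=
  fun X Y => [set T | exists (Z : banachType R k) (V : X -> Z) (U : Z -> Y),
    [/\ A2 X Z V, A1 Z Y U & T = U \o V]].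

Definition composition_gauge (A1 A2 : operator_class)
    (alpha1 alpha2 : operator_gauge) : operator_gauge :=
  fun X Y T => inf [set r | exists (Z : banachType R k)
      (V : X -> Z) (U : Z -> Y),
    [/\ A2 X Z V, A1 Z Y U, T = U \o V & r = alpha1 Z Y U * alpha2 X Z V]].

Definition unit_ball (X : banachType R k) : choiceType :=
  {x : X | `|x| <= 1}.

(* The sum is the limit of the finite partial sums along the directed set of
   finite subsets of the unit ball. *)
Definition canonical_surjection (X : banachType R k)
    (lambda : ell1 R k (unit_ball X)) : X :=
  showcase.summability.sum (fun b : unit_ball X => lambda b *: val b).

Definition surjective_hull (A : operator_class) : operator_class :=
  fun X Y => [set T | bounded_operator T /\
    A (ell1 R k (unit_ball X)) Y (T \o canonical_surjection (X := X))].

Definition surjective_operator_ideal (A : operator_class)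
    (alpha : operator_gauge) : Prop :=
  quasi_normed_operator_ideal A alpha /\ surjective_hull A = A.

End OperatorIdeals.

(* Main.v *)
(* Let T q = U V, where q is the canonical surjection of ell1(B_X) onto X, V : ell1(B_X) -> Z
   is in A2 and U : Z -> Y is in A1.  Let W be the quotient of Z by the closure of V(ker q)
   and Q : Z -> W the quotient map.  Then Q V vanishes on ker q, so Q V = V0 q, and U vanishes
   on V(ker q), so U = U0 Q.  A surjective ideal contains S as soon as it contains S P for
   some metric surjection P, because the canonical surjection onto the domain of S lifts
   through P; hence V0 is in A2, U0 is in A1, and T = U0 V0.

   The quasi-triangle inequality of the composition gauge comes from factorizing a sum through
   the product of the two middle spaces, after rescaling each factorization so that
   alpha1 U <= 1. *)
From HB Require Import structures.
Require Import Defs.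
From mathcomp Require Import all_boot all_order all_algebra finmap complex.
From mathcomp Require Import all_classical all_reals all_analysis.
From mathcomp Require Import ring.
From mathcomp Require showcase.summability.
Set Implicit Arguments.
Unset Strict Implicit.
Unset Printing Implicit Defensive.
Import Order.TTheory GRing.Theory Num.Theory numFieldNormedType.Exports.
Local Open Scope classical_set_scope.
Local Open Scope ring_scope.

(** * Norms, boundedness and operator norms *)

Section ScalarEmbedding.
Variables (R : realType) (k : scalar_kind).
Local Notation K := (scalars R k).
Local Notation re := (@scalar_re R k).
Local Notation ofR := (@scalar_of_real R k).

Lemma scalar_of_realM x y : ofR (x * y) = ofR x * ofR y.
Proof.
rewrite /scalar_of_real; case: k => //=.
by apply/eqP; rewrite eq_complex /= !mul0r !mulr0 subr0 addr0 !eqxx.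
Qed.

Lemma scalar_of_real1 : ofR 1 = 1.
Proof. by rewrite /scalar_of_real; case: k. Qed.

Lemma ltr_scalar_of_real x y : (ofR x < ofR y) = (x < y).
Proof.
by rewrite !lt_neqAle ler_scalar_of_real (inj_eq (can_inj (@scalar_of_realK R k))).
Qed.

Lemma norm_scalar_of_real x : 0 <= x -> `|ofR x| = ofR x.
Proof. by move=> x0; rewrite ger0_norm// -(scalar_of_real0 R k) ler_scalar_of_real. Qed.

Lemma scalar_of_real_gt0 x : 0 < x -> 0 < ofR x.
Proof. by move=> x0; rewrite -(scalar_of_real0 R k) ltr_scalar_of_real. Qed.

(** In the complex case a positive scalar has zero imaginary part. Hence radii in [K] can be
    replaced by real radii in all statements about convergence. *)
Lemma pos_scalar_of_real (e : K) : 0 < e -> exists2 r : R, 0 < r & e = ofR r.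
Proof.
move=> e0; have ee := scalar_reK (ltW e0).
by exists (re e) => //; rewrite -ltr_scalar_of_real ee scalar_of_real0.
Qed.

Lemma scalar_re_normV (a : K) : a != 0 -> re `|a| * re `|a^-1| = 1.
Proof.
move=> a0; apply: (can_inj (@scalar_of_realK R k)).
by rewrite scalar_of_realM !scalar_reK// -normrM mulfV// normr1 scalar_of_real1.
Qed.

Lemma scalar_re_norm_gt0 (a : K) : a != 0 -> 0 < re `|a|.
Proof.
by move=> a0; rewrite -ltr_scalar_of_real scalar_reK// scalar_of_real0 normr_gt0.
Qed.

End ScalarEmbedding.

(** Dividing by [x + 1] instead of [x] allows a constant [x] that may be zero; this choice of slack
    recurs below. *)
Lemma ler_mul_div_succ (R : realType) (x e : R) :
  0 <= x -> 0 < e -> x * (e / (x + 1)) <= e.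
Proof.
move=> x0 e0; rewrite mulrCA ler_piMr ?(ltW e0)//.
by rewrite ler_pdivrMr ?ltr_pwDr// mul1r lerDl.
Qed.

(** * Real-valued norms, convergence and boundedness *)

Section RealNorm.
Variables (R : realType) (k : scalar_kind).
Local Notation K := (scalars R k).
Local Notation re := (@scalar_re R k).
Local Notation ofR := (@scalar_of_real R k).
Implicit Types X Y : banachType R k.

Lemma scalar_of_real_normE X (x : X) : ofR (real_norm x) = `|x|.
Proof. exact: scalar_reK. Qed.

Lemma real_norm_le X (x : X) r : (real_norm x <= r) = (`|x| <= ofR r).
Proof. by rewrite -scalar_of_real_normE ler_scalar_of_real. Qed.

Lemma real_norm_lt X (x : X) r : (real_norm x < r) = (`|x| < ofR r).
Proof. by rewrite -scalar_of_real_normE ltr_scalar_of_real. Qed.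

Lemma real_norm_ge0 X (x : X) : 0 <= real_norm x.
Proof. exact: scalar_re_ge0. Qed.

Lemma real_norm0 X : real_norm (0 : X) = 0.
Proof. by rewrite /real_norm normr0 -(scalar_of_real0 R k) scalar_of_realK. Qed.

Lemma real_norm_eq0 X (x : X) : real_norm x <= 0 -> x = 0.
Proof. by rewrite real_norm_le scalar_of_real0 normr_le0 => /eqP. Qed.

Lemma real_normD X (x y : X) : real_norm (x + y) <= real_norm x + real_norm y.
Proof. by rewrite real_norm_le scalar_of_realD !scalar_of_real_normE ler_normD. Qed.

Lemma real_distC X (x y : X) : real_norm (x - y) = real_norm (y - x).
Proof. by rewrite /real_norm distrC. Qed.

Lemma real_distD X (z x y : X) :
  real_norm (x - y) <= real_norm (x - z) + real_norm (z - y).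
Proof. by rewrite (le_trans _ (real_normD _ _))// addrA subrK. Qed.

Lemma real_normZ X (a : K) (x : X) : real_norm (a *: x) = re `|a| * real_norm x.
Proof.
apply: (can_inj (@scalar_of_realK R k)).
by rewrite scalar_of_realM !scalar_of_real_normE normrZ scalar_reK.
Qed.

Lemma real_normZ_real X r (x : X) : 0 <= r -> real_norm (ofR r *: x) = r * real_norm x.
Proof. by move=> r0; rewrite real_normZ norm_scalar_of_real// scalar_of_realK. Qed.

Lemma real_norm_sum X (I : Type) (s : seq I) (f : I -> X) :
  real_norm (\sum_(i <- s) f i) <= \sum_(i <- s) real_norm (f i).
Proof.
elim/big_rec2: _ => [|i y x _ xy]; first by rewrite real_norm0.
by rewrite (le_trans (real_normD _ _))// lerD2l.
Qed.

Lemma cvg_real_norm X (F : set_system X) {FF : Filter F} (l : X) :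
  F --> l <-> forall e : R, 0 < e -> F [set x | real_norm (l - x) < e].
Proof.
split=> [/cvgrPdist_lt Fl e e0|Fl].
  have := Fl _ (scalar_of_real_gt0 k e0).
  by apply: filterS => x; rewrite /= real_norm_lt.
apply/cvgrPdist_lt => e /pos_scalar_of_real[r r0 ->].
by have := Fl _ r0; apply: filterS => x /=; rewrite /= real_norm_lt.
Qed.

Lemma cauchy_real_norm X (F : set_system X) {FF : ProperFilter F} :
  (cauchy F <->
    forall e : R, 0 < e -> exists x, F [set y | real_norm (x - y) < e]).
Proof.
split=> [/cauchyP cF e e0|cF].
  have [x Fx] := cF _ (scalar_of_real_gt0 k e0); exists x.
  by apply: filterS Fx => y; rewrite -ball_normE /= real_norm_lt.
apply/cauchyP => e /pos_scalar_of_real[r r0 ->].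
have [x Fx] := cF _ r0; exists x.
by apply: filterS Fx => y; rewrite -ball_normE /= real_norm_lt.
Qed.

Lemma bounded_operatorP X Y (T : X -> Y) :
  bounded_operator T <->
  linear T /\ exists2 C : R, 0 <= C & forall x, real_norm (T x) <= C * real_norm x.
Proof.
split=> -[lT]; pose Tm := GRing.isLinear.Build _ _ _ _ T lT;
  pose TL : {linear X -> Y} := HB.pack T Tm.
  move=> cT; split => //.
  have /linear_boundedP/pinfty_ex_gt0[M] :=
    (@continuous_linear_bounded _ _ _ 0 TL (cT 0)).
  move=> /pos_scalar_of_real[C C0 ->] TM; exists C; first exact: ltW.
  by move=> x; rewrite real_norm_le scalar_of_realM scalar_of_real_normE; exact: TM.
move=> [C C0 TC]; split => //; apply: (@bounded_linear_continuous _ _ _ TL).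
apply/linear_boundedP; near=> r => x.
rewrite (@le_trans _ _ (ofR C * `|x|))//.
  by rewrite -[X in _ * X]scalar_of_real_normE -scalar_of_realM -real_norm_le; exact: TC.
(* The filter at infinity lives on [K], so its lower bound [ofR C] has to be shown to be a real
   element of [K]. *)
rewrite ler_wpM2r//; near: r; apply: nbhs_pinfty_ge.
by rewrite ger0_real// -(scalar_of_real0 R k) ler_scalar_of_real.
Unshelve. all: by end_near. Qed.

End RealNorm.

(** * Linear maps as bare functions, and operator norms *)

Section OperatorNorm.
Variables (R : realType) (k : scalar_kind).
Local Notation K := (scalars R k).
Local Notation re := (@scalar_re R k).
Local Notation ofR := (@scalar_of_real R k).
Implicit Types X Y Z : banachType R k.

Section LinearPredicate.
Variables (X Y : lmodType K) (T : X -> Y) (lT : linear T).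

(** Operator classes consist of bare functions, with linearity as a hypothesis. The usual laws are
    therefore derived from the predicate, without bundling. *)
Lemma linear_pred0 : T 0 = 0.
Proof. by have := lT (-1) 0 0; rewrite scaler0 addr0 scaleN1r addNr. Qed.

Lemma linear_predD x y : T (x + y) = T x + T y.
Proof. by have := lT 1 x y; rewrite !scale1r. Qed.

Lemma linear_predZ a x : T (a *: x) = a *: T x.
Proof. by have := lT a x 0; rewrite linear_pred0 !addr0. Qed.

Lemma linear_predB x y : T (x - y) = T x - T y.
Proof. by rewrite linear_predD -scaleN1r linear_predZ scaleN1r. Qed.

End LinearPredicate.

Lemma operator_norm_ub X Y (T : X -> Y) : bounded_operator T ->
  forall x, real_norm (T x) <= operator_norm T * real_norm x.
Proof.
move=> bT x; have [lT [C C0 TC]] := (bounded_operatorP T).1 bT.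
have [x0|x0] := leP (real_norm x) 0.
  by rewrite (real_norm_eq0 x0) (linear_pred0 lT) !real_norm0 mulr0.
rewrite -ler_pdivrMr// mulrC -real_normZ_real ?invr_ge0 ?real_norm_ge0//.
rewrite -(linear_predZ lT); apply: ub_le_sup.
  exists C => _ [y /= y1 <-]; rewrite (le_trans (TC y))// ler_piMr//.
  by rewrite real_norm_le scalar_of_real1.
(* The supremum runs over the closed unit ball, so [x] enters through its normalization; the zero
   vector was treated above. *)
exists (ofR (real_norm x)^-1 *: x) => //=.
rewrite -(scalar_of_real1 R k) -real_norm_le real_normZ_real ?invr_ge0 ?real_norm_ge0//.
by rewrite mulVf// gt_eqF.
Qed.

Lemma operator_norm_le X Y (T : X -> Y) (C : R) : 0 <= C ->
  (forall x, real_norm (T x) <= C * real_norm x) -> operator_norm T <= C.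
Proof.
move=> C0 TC; apply: sup_le_ub.
  by exists (real_norm (T 0)), 0 => //=; rewrite normr0.
move=> _ [y /= y1 <-]; rewrite (le_trans (TC y))// ler_piMr//.
by rewrite real_norm_le scalar_of_real1.
Qed.

Lemma operator_norm_ge0 X Y (T : X -> Y) : bounded_operator T ->
  0 <= operator_norm T.
Proof.
move=> bT; have [lT [C C0 TC]] := (bounded_operatorP T).1 bT.
apply: ub_le_sup.
  exists C => _ [y /= y1 <-]; rewrite (le_trans (TC y))// ler_piMr//.
  by rewrite real_norm_le scalar_of_real1.
by exists 0; rewrite /= ?normr0// (linear_pred0 lT) real_norm0.
Qed.

Lemma bounded_operator_comp X Y Z (S : X -> Y) (T : Y -> Z) :
  bounded_operator S -> bounded_operator T -> bounded_operator (T \o S).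
Proof.
move=> [lS cS] [lT cT]; split=> [a x y /=|x]; first by rewrite lS lT.
exact: (continuous_comp (cS x) (cT _)).
Qed.

Lemma operator_norm_comp X Y Z (S : X -> Y) (T : Y -> Z) :
  bounded_operator S -> bounded_operator T ->
  operator_norm (T \o S) <= operator_norm T * operator_norm S.
Proof.
move=> bS bT; apply: operator_norm_le => [|x].
  by rewrite mulr_ge0 ?operator_norm_ge0.
rewrite (le_trans (operator_norm_ub bT _))// -mulrA ler_wpM2l ?operator_norm_ge0//.
exact: operator_norm_ub.
Qed.

Lemma bounded_operator_id X : bounded_operator (@idfun X).
Proof. by split=> // x; exact: cvg_id. Qed.

Lemma operator_norm_id X : operator_norm (@idfun X) <= 1.
Proof. by apply: operator_norm_le => // x; rewrite mul1r. Qed.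

(** The scalar 1 is a vector of norm 1. This supplies the lower bound for the composition gauge of
    the identity. *)
Lemma operator_norm_scalar_line : operator_norm (@idfun (scalar_line R k)) = 1.
Proof.
apply/eqP; rewrite eq_le operator_norm_id /=.
have n1 : real_norm (1 : scalar_line R k) = 1.
  by rewrite /real_norm normr1 -(scalar_of_real1 R k) scalar_of_realK.
have := operator_norm_ub (bounded_operator_id (scalar_line R k)) 1.
by rewrite /= n1 mulr1.
Qed.

Lemma bounded_operator_scale X Y (T : X -> Y) (c : K) :
  bounded_operator T -> bounded_operator (fun x => c *: T x).
Proof.
move=> /bounded_operatorP[lT [C C0 TC]]; apply/bounded_operatorP; split.
  by move=> a x y; rewrite lT scalerDr !scalerA mulrC.
exists (re `|c| * C); first by rewrite mulr_ge0// scalar_re_ge0.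
by move=> x; rewrite real_normZ -mulrA ler_wpM2l// scalar_re_ge0.
Qed.

Lemma contraction_bounded X Y (T : X -> Y) :
  linear T -> (forall x, real_norm (T x) <= real_norm x) ->
  bounded_operator T /\ operator_norm T <= 1.
Proof.
move=> lT Tn; split; last by apply: operator_norm_le => // x; rewrite mul1r.
by apply/bounded_operatorP; split => //; exists 1 => // x; rewrite mul1r.
Qed.

End OperatorNorm.

(** * Summation over ell1 and metric surjections *)

Section Ell1Sums.
Variables (R : realType) (k : scalar_kind) (I : choiceType).
Local Notation K := (scalars R k).
Local Notation re := (@scalar_re R k).
Local Notation ofR := (@scalar_of_real R k).
Local Notation ell1 := (ell1 R k I).
Local Notation partial_sum := showcase.summability.partial_sum.
Local Notation totally := showcase.summability.totally.
Local Existing Instance showcase.summability.totally_filter.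
Import finmap.

Lemma ell1_real_sum_le (f : ell1) (s : seq I) : uniq s ->
  \sum_(i <- s) re `|f i| <= real_norm f.
Proof.
move=> us; rewrite -(@ler_scalar_of_real R k) scalar_of_real_normE scalar_of_real_sum.
under eq_bigr => i _ do rewrite scalar_reK//.
exact: ell1_sum_le.
Qed.

(** Take a finite set whose partial sum exceeds the norm minus [e]. Indices outside it contribute
    less than [e], since together with it they still stay below the norm. *)
Lemma ell1_tail (f : ell1) (e : R) : 0 < e -> exists A : {fset I},
  forall B, (A `<=` B)%fset -> \sum_(i <- (B `\` A)%fset) re `|f i| < e.
Proof.
move=> e0; have [s us fs] :
    exists2 s : seq I, uniq s & real_norm f - e < \sum_(i <- s) re `|f i|.
  (* Otherwise [real_norm f - e] would bound every finite partial sum, hence the norm itself. *)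
  apply: contrapT => nex; have : real_norm f <= real_norm f - e.
    rewrite real_norm_le; apply: ell1_normK_le => s us.
    rewrite -(eq_bigr _ (fun i _ => scalar_reK (normr_ge0 (f i)))).
    rewrite -scalar_of_real_sum ler_scalar_of_real leNgt; apply/negP => fs.
    by apply: nex; exists s.
  by rewrite leNgt ltrBlDr ltrDl e0.
exists [fset i in s]%fset => B sB.
have := @ell1_real_sum_le f (s ++ (B `\` [fset i in s])%fset).
rewrite cat_uniq us fset_uniq andbT big_cat /= => /(_ _)/le_trans le_f.
have : ~~ has (in_mem^~ (mem s)) (B `\` [fset i in s])%fset.
  by apply/hasPn => i; rewrite !inE /= => /andP[].
move=> /le_f/(_ (lexx _)) H.
rewrite -(ltrD2l (\sum_(i <- s) re `|f i|)) (le_lt_trans H)//.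
by rewrite -ltrBlDr.
Qed.

Lemma partial_sumE (X : zmodType) (x : I -> X) (A : {fset I}) :
  partial_sum x A = \sum_(i <- A) x i.
Proof. by rewrite /partial_sum big_seq_fsetE. Qed.

Section BoundedFamily.
Variables (X : banachType R k) (z : I -> X) (C : R).
Hypothesis zC : forall i, real_norm (z i) <= C.

Lemma partial_sum_le (f : ell1) (s : seq I) :
  real_norm (\sum_(i <- s) f i *: z i) <= C * \sum_(i <- s) re `|f i|.
Proof.
rewrite (le_trans (real_norm_sum _ _))// mulr_sumr; apply: ler_sum => i _.
by rewrite real_normZ mulrC ler_wpM2r// scalar_re_ge0.
Qed.

Lemma ell1_sum_cvg (f : ell1) :
  partial_sum (fun i => f i *: z i) @ totally -->
    showcase.summability.sum (fun i => f i *: z i).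
Proof.
apply: (@cauchy_cvg X) => //; apply/cauchy_real_norm => e e0.
(* The tolerance is [e / (|C| + 1)]; the absolute value is there because [C] may be negative when
   [I] is empty. *)
have [A fA] := ell1_tail f (divr_gt0 e0 (ltr_pwDr ltr01 (normr_ge0 C))).
exists (\sum_(i <- A) f i *: z i); exists A => // B /= AB.
rewrite partial_sumE real_distC.
have -> : (\sum_(i <- B) f i *: z i =
    \sum_(i <- A) f i *: z i + \sum_(i <- (B `\` A)%fset) f i *: z i).
  rewrite -big_cat /=; apply: perm_big; apply: uniq_perm => //.
    rewrite cat_uniq !fset_uniq andbT /=; apply/hasPn => i.
    by rewrite inE => /andP[].
  move=> i; rewrite mem_cat inE.
  by case: (boolP (i \in A)) => //= /(fsubsetP AB) ->.
rewrite addrC addKr (le_lt_trans (partial_sum_le _ _))//.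
have := fA _ AB; rewrite ltr_pdivlMr ?ltr_pwDr//; apply: le_lt_trans.
rewrite mulrC ler_wpM2l//; first by apply: sumr_ge0 => i _; exact: scalar_re_ge0.
by rewrite (le_trans (ler_norm _))// lerDl.
Qed.

Lemma ell1_sum_bounded : bounded_operator
  (fun f : ell1 => showcase.summability.sum (fun i => f i *: z i)).
Proof.
apply/bounded_operatorP; split=> [a f g|].
  apply: (@cvg_lim X) => //.
  have -> : partial_sum (fun i => (a *: f + g) i *: z i) =
      (fun A => a *: partial_sum (fun i => f i *: z i) A +
         partial_sum (fun i => g i *: z i) A).
    apply/funext => A; rewrite !partial_sumE scaler_sumr -big_split /=.
    by apply: eq_bigr => i _; rewrite scalerA -scalerDl.
  by apply: cvgD; [apply: cvgZr|]; exact: ell1_sum_cvg.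
(* For empty [I] the sign of [C] is unknown, but every sum is zero and the constant 0 serves.
   Otherwise some [z i] forces [C] to be nonnegative. *)
have [I0|I0] := pselect (inhabited I); last first.
  exists 0 => // f; rewrite mul0r [X in real_norm X](_ : _ = 0) ?real_norm0//.
  apply: (@cvg_lim X) => //; apply: cvg_near_cst; exists fset0%fset => // A _ /=.
  by rewrite partial_sumE big1// => i; case: I0; split.
have C0 : 0 <= C by case: I0 => i; rewrite (le_trans (real_norm_ge0 _) (zC i)).
exists C => // f; apply/ler_addgt0Pr => e e0.
have /(cvg_real_norm _).1/(_ _ e0)[A _ fA] := @ell1_sum_cvg f.
set l := showcase.summability.sum _ in fA *.
rewrite -[l](subrK (partial_sum (fun i => f i *: z i) A)).
rewrite (le_trans (real_normD _ _))// addrC lerD ?(ltW (fA _ (fsubset_refl A)))//.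
rewrite partial_sumE (le_trans (partial_sum_le _ _))// ler_wpM2l//.
exact: ell1_real_sum_le.
Qed.

Lemma bounded_operator_ell1_sum (Y : banachType R k) (T : X -> Y) (f : ell1) :
  bounded_operator T ->
  T (showcase.summability.sum (fun i => f i *: z i)) =
    showcase.summability.sum (fun i => f i *: T (z i)).
Proof.
move=> [lT cT]; apply/esym; apply: (@cvg_lim Y) => //.
have -> : partial_sum (fun i => f i *: T (z i)) =
    T \o partial_sum (fun i => f i *: z i).
  apply/funext => A /=; rewrite !partial_sumE.
  elim/big_rec2: _ => [|i x y _ ->]; first by rewrite (linear_pred0 lT).
  by rewrite (linear_predD lT) (linear_predZ lT).
by apply: continuous_cvg; [exact: cT|exact: ell1_sum_cvg].
Qed.

End BoundedFamily.

Section UnitVector.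
Variable b : I.

Lemma ell1_unit_bound (s : seq I) : uniq s ->
  \sum_(i <- s) `|((i == b)%:R : K)| <= 1.
Proof.
move=> us; have [bs|bs] := boolP (b \in s); last first.
  rewrite big_seq big1 // => i si; case: eqP => [ib|]; last by rewrite normr0.
  by rewrite -ib si in bs.
rewrite (bigD1_seq b) //= eqxx normr1 big1 ?addr0//.
by move=> i /negPf ->; rewrite normr0.
Qed.

Definition ell1_unit : ell1 :=
  Ell1 (ell1_pred_bound (f := fun i => (i == b)%:R) ell1_unit_bound).1.

Lemma ell1_unit_norm : real_norm ell1_unit <= 1.
Proof.
rewrite real_norm_le scalar_of_real1.
exact: (ell1_pred_bound (f := fun i => (i == b)%:R) ell1_unit_bound).2.
Qed.

(** The partial sums are constant as soon as the finite index set contains [b]. *)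
Lemma ell1_sum_unit (X : banachType R k) (z : I -> X) :
  showcase.summability.sum (fun i => ell1_unit i *: z i) = z b.
Proof.
apply: (@cvg_lim X) => //; apply: cvg_near_cst; exists [fset b]%fset => // A /= bA.
rewrite partial_sumE (big_fsetD1 b) /= ?eqxx ?scale1r; last by rewrite -fsub1set.
rewrite big_seq_cond big1 ?addr0// => i.
by rewrite !inE => /andP[/andP[/negPf -> _] _]; rewrite scale0r.
Qed.

End UnitVector.
End Ell1Sums.

(** * The canonical surjection from ell1 of the unit ball *)

Section CanonicalSurjection.
Variables (R : realType) (k : scalar_kind) (X : banachType R k).
Local Notation ofR := (@scalar_of_real R k).
Local Notation q := (@canonical_surjection R k X).

Lemma unit_ball_norm (b : unit_ball X) : real_norm (val b) <= 1.
Proof. by rewrite real_norm_le scalar_of_real1; exact: (valP b). Qed.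

Lemma canonical_surjection_bounded : bounded_operator q.
Proof. exact: (ell1_sum_bounded unit_ball_norm). Qed.

(** A nonzero [x] is its norm times a point [b] of the unit ball, so the same multiple of the unit
    vector at [b] is a preimage. *)
Lemma canonical_surjection_lift x : exists2 f, q f = x & real_norm f <= real_norm x.
Proof.
have [lq _] := canonical_surjection_bounded.
have [x0|x0] := leP (real_norm x) 0.
  by exists 0; rewrite ?real_norm0 ?real_norm_ge0// (linear_pred0 lq) (real_norm_eq0 x0).
have x1 : `|ofR (real_norm x)^-1 *: x| <= 1.
  rewrite -(scalar_of_real1 R k) -real_norm_le real_normZ_real ?invr_ge0 ?(ltW x0)//.
  by rewrite mulVf// gt_eqF.
pose b : unit_ball X := exist (fun y : X => `|y| <= 1) _ x1.
exists (ofR (real_norm x) *: ell1_unit R k b).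
  rewrite (linear_predZ lq) /canonical_surjection ell1_sum_unit /= scalerA.
  by rewrite -scalar_of_realM mulfV ?gt_eqF// scalar_of_real1 scale1r.
by rewrite real_normZ_real ?(ltW x0)// ler_piMr ?(ltW x0)// ell1_unit_norm.
Qed.

End CanonicalSurjection.

(** * Metric surjections: lifting and descent *)

Section MetricSurjection.
Variables (R : realType) (k : scalar_kind).
Implicit Types X Y Z : banachType R k.

(* Weaker than the usual notion: [Q] may have norm greater than 1. *)
Definition metric_surjection X Y (Q : X -> Y) : Prop :=
  bounded_operator Q /\ forall y r, real_norm y < r ->
    exists2 x, Q x = y & real_norm x < r.

Lemma canonical_surjection_metric X :
  metric_surjection (@canonical_surjection R k X).
Proof.
split=> [|x r xr]; first exact: canonical_surjection_bounded.
have [f qf fx] := canonical_surjection_lift x.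
by exists f => //; exact: le_lt_trans xr.
Qed.

(* The lifting property of ell1: a bounded family of preimages of the elements of
   the unit ball determines the lift. *)
Lemma canonical_surjection_factor Z Y (Q : Z -> Y) : metric_surjection Q ->
  exists2 L : ell1 R k (unit_ball Y) -> Z,
    bounded_operator L & Q \o L = canonical_surjection (X := Y).
Proof.
move=> [bQ lift].
(* Lifts are available only below a radius strictly larger than the norm; any uniform bound above 1
   would do in place of 2. *)
have /choice[z zP] (b : unit_ball Y) : exists z, Q z = val b /\ real_norm z <= 2.
  have [|z zb z2] := lift (val b) 2; last by exists z; rewrite ltW.
  by rewrite (le_lt_trans (unit_ball_norm b))// ltr1n.
exists (fun f => showcase.summability.sum (fun b => f b *: z b)).
  exact: (ell1_sum_bounded (fun b => (zP b).2)).
apply/funext => f /=; rewrite (bounded_operator_ell1_sum (fun b => (zP b).2))//.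
by congr showcase.summability.sum; apply/funext => b; rewrite (zP b).1.
Qed.

(** The value at [x] is that of [S] at any preimage; the kernel condition makes it independent of
    the choice, and preimages of controlled norm make it bounded. *)
Lemma metric_surjection_descend Z X Y (Q : Z -> X) (S : Z -> Y) :
  metric_surjection Q -> bounded_operator S -> (forall z, Q z = 0 -> S z = 0) ->
  exists2 T : X -> Y, bounded_operator T & T \o Q = S.
Proof.
move=> [[lQ cQ] lift] bS kerQ.
have [lS [C C0 SC]] := (bounded_operatorP S).1 bS.
have eqS z w : Q z = Q w -> S z = S w.
  move=> zw; apply/eqP; rewrite -subr_eq0 -(linear_predB lS); apply/eqP.
  by apply: kerQ; rewrite (linear_predB lQ) zw subrr.
have /choice[s sK] x : exists z, Q z = x.
  by have [|z] := lift x (real_norm x + 1); [rewrite ltrDl|exists z].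
exists (S \o s); last by apply/funext => z /=; apply: eqS; rewrite sK.
apply/bounded_operatorP; split=> [a x y /=|].
  by rewrite -lS; apply: eqS; rewrite lQ !sK.
(* The section [s] has no norm control, so the estimate is made on another preimage, of norm below
   [real_norm x + e / (C + 1)]. *)
exists C => // x /=; apply/ler_addgt0Pr => e e0.
have C1 : 0 < C + 1 by rewrite ltr_pwDr.
have [|z zx zr] := lift x (real_norm x + e / (C + 1)); first by rewrite ltrDl divr_gt0.
rewrite (eqS _ z) ?sK// (le_trans (SC z))// (le_trans (ler_wpM2l C0 (ltW zr)))//.
by rewrite mulrDr lerD2l ler_mul_div_succ.
Qed.

End MetricSurjection.

(** * Quotients and products of Banach spaces *)

Section QuotientSeminorm.
Variables (R : realType) (k : scalar_kind) (X : banachType R k).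
Variable (N : submodClosed X).
Local Notation K := (scalars R k).
Local Notation re := (@scalar_re R k).
Local Notation ofR := (@scalar_of_real R k).

(** This is the quotient seminorm modulo [N]; it vanishes on the whole closure of [N]. *)
Definition subspace_dist (x : X) : R :=
  inf [set real_norm (x - n) | n in [set n | n \in N]].

Lemma subspace_dist_le x n : n \in N -> subspace_dist x <= real_norm (x - n).
Proof.
move=> Nn; apply: ge_inf; last by exists n.
by exists 0 => _ [m _ <-]; exact: real_norm_ge0.
Qed.

Lemma subspace_dist_ge0 x : 0 <= subspace_dist x.
Proof.
apply: lb_le_inf; first by exists (real_norm (x - 0)), 0 => //=; exact: rpred0.
by move=> _ [m _ <-]; exact: real_norm_ge0.
Qed.

Lemma subspace_dist_lt x r : subspace_dist x < r ->
  exists2 n, n \in N & real_norm (x - n) < r.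
Proof.
move=> xr; apply: contrapT => nex; move: xr; rewrite ltNge => /negP; apply.
apply: lb_le_inf; first by exists (real_norm (x - 0)), 0 => //=; exact: rpred0.
by move=> _ [m Nm <-]; rewrite leNgt; apply/negP => h; apply: nex; exists m.
Qed.

Lemma subspace_distD x y :
  subspace_dist (x + y) <= subspace_dist x + subspace_dist y.
Proof.
apply/ler_addgt0Pr => e e0; have e2 : 0 < e / 2 by rewrite divr_gt0.
have [n Nn xn] : exists2 n, n \in N & real_norm (x - n) < subspace_dist x + e / 2.
  by apply: subspace_dist_lt; rewrite ltrDl.
have [m Nm ym] : exists2 n, n \in N & real_norm (y - n) < subspace_dist y + e / 2.
  by apply: subspace_dist_lt; rewrite ltrDl.
rewrite (le_trans (subspace_dist_le _ (rpredD Nn Nm)))//.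
rewrite opprD addrACA (le_trans (real_normD _ _))//.
by rewrite (splitr e) [leRHS]addrACA lerD// ltW.
Qed.

Lemma subspace_distZ_le a x : subspace_dist (a *: x) <= re `|a| * subspace_dist x.
Proof.
apply/ler_addgt0Pr => e e0.
have a0 : 0 <= re `|a| by exact: scalar_re_ge0.
have a1 : 0 < re `|a| + 1 by rewrite ltr_pwDr.
have [n Nn xn] : exists2 n, n \in N &
    real_norm (x - n) < subspace_dist x + e / (re `|a| + 1).
  by apply: subspace_dist_lt; rewrite ltrDl divr_gt0.
rewrite (le_trans (subspace_dist_le _ (rpredZ a Nn)))//.
rewrite -scalerBr real_normZ (le_trans (ler_wpM2l a0 (ltW xn)))//.
by rewrite mulrDr lerD2l ler_mul_div_succ.
Qed.

Lemma subspace_distN x : subspace_dist (- x) = subspace_dist x.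
Proof.
have H y : subspace_dist (- y) <= subspace_dist y.
  rewrite -scaleN1r (le_trans (subspace_distZ_le _ _))// normrN1.
  by rewrite -(scalar_of_real1 R k) scalar_of_realK mul1r.
by apply/eqP; rewrite eq_le H -{1}(opprK x) H.
Qed.

Lemma subspace_dist0 n : n \in N -> subspace_dist n = 0.
Proof.
move=> Nn; apply/eqP; rewrite eq_le subspace_dist_ge0 andbT.
by rewrite (le_trans (subspace_dist_le _ Nn))// subrr real_norm0.
Qed.

(** Describing the closure as the null space of the seminorm makes the induced function on the
    quotient definite, hence a norm. *)
Definition subspace_closure : {pred X} := fun x => `[< subspace_dist x = 0 >].

Lemma subspace_closureP x : x \in subspace_closure <-> subspace_dist x = 0.
Proof. by split=> [/asboolP|? ]; last exact/asboolP. Qed.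

Lemma subspace_closure_submod : submod_closed subspace_closure.
Proof.
split; first by apply/subspace_closureP; apply: subspace_dist0; exact: rpred0.
move=> a x y /subspace_closureP x0 /subspace_closureP y0; apply/subspace_closureP.
apply/eqP; rewrite eq_le subspace_dist_ge0 andbT.
rewrite (le_trans (subspace_distD _ _))// y0 addr0.
by rewrite (le_trans (subspace_distZ_le _ _))// x0 mulr0.
Qed.

HB.instance Definition _ :=
  GRing.isSubmodClosed.Build K X subspace_closure subspace_closure_submod.

(** The algebraic quotient supplies the additive group; scaling and norm are added through chosen
    representatives. *)
Definition quotient_space : Type := Quotient.quot subspace_closure.

HB.instance Definition _ := GRing.Zmodule.on quotient_space.

Definition quotient_map (x : X) : quotient_space :=
  \pi_(Quotient.quot subspace_closure)%qT x.

Definition quotient_repr (u : quotient_space) : X :=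
  repr (u : Quotient.quot subspace_closure).

Lemma quotient_reprK u : quotient_map (quotient_repr u) = u.
Proof. exact: reprK. Qed.

Lemma quotient_mapB x y : quotient_map (x - y) = quotient_map x - quotient_map y.
Proof. exact: (raddfB (\pi_(Quotient.quot subspace_closure)%qT)). Qed.

Lemma quotient_mapD x y : quotient_map (x + y) = quotient_map x + quotient_map y.
Proof. exact: (raddfD (\pi_(Quotient.quot subspace_closure)%qT)). Qed.

Lemma quotient_map_eq x y :
  quotient_map x = quotient_map y <-> subspace_dist (x - y) = 0.
Proof.
rewrite -subspace_closureP Quotient.idealrBE; split=> [xy|/eqP//].
exact/eqP.
Qed.

Definition quotient_scale (a : K) (u : quotient_space) :=
  quotient_map (a *: quotient_repr u).

(** Scaling does not depend on the representative because the closure is stable under scalars. The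
    module axioms then transfer from [X]. *)
Lemma quotient_mapZ a x : quotient_map (a *: x) = quotient_scale a (quotient_map x).
Proof.
apply/quotient_map_eq; rewrite -scalerBr; apply/subspace_closureP.
apply: rpredZ; apply/subspace_closureP/quotient_map_eq.
by rewrite quotient_reprK.
Qed.

Lemma quotient_scaleA a b u :
  quotient_scale a (quotient_scale b u) = quotient_scale (a * b) u.
Proof. by rewrite -[u]quotient_reprK -!quotient_mapZ scalerA. Qed.

Lemma quotient_scale1 : left_id 1 quotient_scale.
Proof. by move=> u; rewrite -[u]quotient_reprK -quotient_mapZ scale1r. Qed.

Lemma quotient_scaleDr : right_distributive quotient_scale +%R.
Proof.
move=> a u v; rewrite -[u]quotient_reprK -[v]quotient_reprK.
by rewrite -quotient_mapD -!quotient_mapZ scalerDr quotient_mapD.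
Qed.

Lemma quotient_scaleDl u : {morph quotient_scale^~ u : a b / a + b}.
Proof.
move=> a b; rewrite -[u]quotient_reprK.
by rewrite -!quotient_mapZ scalerDl quotient_mapD.
Qed.

HB.instance Definition _ := GRing.Zmodule_isLmodule.Build K quotient_space
  quotient_scaleA quotient_scale1 quotient_scaleDr quotient_scaleDl.

Lemma quotient_map_linear : linear quotient_map.
Proof. by move=> a x y; rewrite quotient_mapD quotient_mapZ. Qed.

Definition quotient_norm (u : quotient_space) : K :=
  ofR (subspace_dist (quotient_repr u)).

(** By the triangle inequality, two points whose difference has seminorm zero have the same
    seminorm, so any representative computes the norm. *)
Lemma quotient_norm_map x : quotient_norm (quotient_map x) = ofR (subspace_dist x).
Proof.
have H y z : subspace_dist (y - z) = 0 -> subspace_dist y <= subspace_dist z.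
  by move=> yz; rewrite -{1}(subrK z y) (le_trans (subspace_distD _ _))// yz add0r.
have xx : subspace_dist (quotient_repr (quotient_map x) - x) = 0.
  by apply/quotient_map_eq; rewrite quotient_reprK.
congr ofR; apply/eqP; rewrite eq_le !H//.
by rewrite -subspace_distN opprB.
Qed.

Lemma quotient_normD u v : quotient_norm (u + v) <= quotient_norm u + quotient_norm v.
Proof.
rewrite -[u]quotient_reprK -[v]quotient_reprK -quotient_mapD !quotient_norm_map.
by rewrite -scalar_of_realD ler_scalar_of_real subspace_distD.
Qed.

Lemma quotient_normZ a u : quotient_norm (a *: u) = `|a| * quotient_norm u.
Proof.
rewrite -[u]quotient_reprK -(linear_predZ quotient_map_linear) !quotient_norm_map.
rewrite -[X in X * _]scalar_reK// -scalar_of_realM; congr ofR.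
set x := quotient_repr u; apply/eqP; rewrite eq_le subspace_distZ_le /=.
have [->|a0] := eqVneq a 0.
  by rewrite normr0 -(scalar_of_real0 R k) scalar_of_realK mul0r subspace_dist_ge0.
have ra := scalar_re_norm_gt0 a0.
(* The reverse inequality is the one already known, applied to [a^-1] and [a *: x]. *)
have -> : subspace_dist x = subspace_dist (a^-1 *: (a *: x)) by rewrite scalerK.
by rewrite (le_trans (ler_wpM2l (ltW ra) (subspace_distZ_le _ _)))// mulrA
  scalar_re_normV// mul1r.
Qed.

Lemma quotient_norm_eq0 u : quotient_norm u = 0 -> u = 0.
Proof.
rewrite -(scalar_of_real0 R k) => /(can_inj (@scalar_of_realK R k)) u0.
rewrite -[u]quotient_reprK -(linear_pred0 quotient_map_linear).
by apply/quotient_map_eq; rewrite subr0.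
Qed.

HB.instance Definition _ := Lmodule_isNormed.Build K quotient_space
  quotient_normD quotient_normZ quotient_norm_eq0.

Lemma quotient_normE (x : X) : `|quotient_map x| = ofR (subspace_dist x).
Proof. exact: quotient_norm_map. Qed.

Lemma quotient_map_norm_le x : `|quotient_map x| <= `|x|.
Proof.
rewrite quotient_normE -scalar_of_real_normE ler_scalar_of_real -{2}(subr0 x).
exact: subspace_dist_le (rpred0 _).
Qed.

(** Consecutive representatives are close up to a correction [m n] in [N]. Adding the accumulated
    corrections to the [n]-th representative keeps its class and makes the differences themselves
    small. *)
Lemma quotient_cauchy_lift (x : nat -> quotient_space) (e : nat -> R) :
  (forall n, `|x n - x n.+1| < ofR (e n)) ->
  exists2 z : nat -> X, forall n, quotient_map (z n) = x n &
    forall n, real_norm (z n - z n.+1) < e n.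
Proof.
move=> xe; pose y n := quotient_repr (x n).
have /choice[m mP] n : exists m, m \in N /\ real_norm (y n - y n.+1 - m) < e n.
  have : subspace_dist (y n - y n.+1) < e n.
    rewrite -(@ltr_scalar_of_real R k) -quotient_normE quotient_mapB.
    by rewrite !quotient_reprK.
  by move=> /subspace_dist_lt[m]; exists m.
exists (fun n => y n + \sum_(i < n) m i) => n.
  rewrite -[RHS]quotient_reprK; apply/quotient_map_eq; rewrite addrC addKr.
  by apply: subspace_dist0; apply: rpred_sum => i _; exact: (mP i).1.
rewrite big_ord_recr /= opprD addrACA opprD addrA addrA.
rewrite [X in real_norm X](_ : _ = y n - y n.+1 - m n).
  exact: (mP n).2.
by rewrite addrK.
Qed.

(** Points [x n] approximating the filter within [1 / 2 ^+ n] are lifted to a Cauchy sequence of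
    [X]; the image of its limit is the limit of [F]. *)
Lemma quotient_complete (F : set_system quotient_space) :
  ProperFilter F -> cauchy F -> cvg F.
Proof.
move=> FF /cauchyP cF; pose e n : R := 1 / 2 ^+ n.
have e0 n : 0 < e n by rewrite divr_gt0// exprn_gt0.
have eS n : e n = e n.+1 + e n.+1.
  by rewrite /e exprS invfM !mul1r -mulrDl -[X in (X + X) * _]div1r -splitr mul1r.
have /choice[x xF] n : exists x, F [set u | `|x - u| < ofR (e n)].
  have [x Fx] := cF _ (scalar_of_real_gt0 k (e0 n)).
  by exists x; move: Fx; rewrite -ball_normE.
have xe n : `|x n - x n.+1| < ofR (e n + e n.+1).
  have [u [/= xu xu']] := filter_ex (filterI (xF n) (xF n.+1)).
  rewrite scalar_of_realD -(subrK u (x n)) -addrA (le_lt_trans (ler_normD _ _))//.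
  by rewrite ltrD// distrC.
have [z zx ze] := quotient_cauchy_lift xe.
(* Since [e n] is twice [e n.+1], the step bound [e n + e n.+1] equals [3 * (e n - e n.+1)], which
   telescopes. *)
have zd n j : real_norm (z n - z (n + j)%N) <= 3 * (e n - e (n + j)%N).
  elim: j => [|j IH]; first by rewrite addn0 !subrr real_norm0 mulr0.
  rewrite addnS (le_trans (real_distD (z (n + j)%N) _ _))//.
  rewrite (le_trans (lerD IH (ltW (ze _))))// (eS (n + j)%N).
  by rewrite le_eqVlt; apply/orP; left; apply/eqP; ring.
have : cvg (z @ \oo).
  apply: (@cauchy_cvg X); apply/cauchy_real_norm => d d0.
  (* The tolerance [d / 3] absorbs the factor 3 of the telescoped bound. *)
  have [n _ nd] := near_infty_natSinv_expn_lt (PosNum (divr_gt0 d0 (ltr0Sn R 2))).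
  exists (z n); exists n => // j /= nj; rewrite -(subnKC nj).
  rewrite (le_lt_trans (zd _ _))// (@le_lt_trans _ _ (3 * e n))//.
    by rewrite ler_wpM2l// lerBlDr lerDl ltW.
  by rewrite mulrC -ltr_pdivlMr//; exact: nd (leqnn n).
move=> /cvg_ex[l /cvg_real_norm zl]; apply/cvg_ex; exists (quotient_map l).
apply/cvgrPdist_lt => _ /pos_scalar_of_real[r r0 ->].
have r2 : 0 < r / 2 by rewrite divr_gt0.
have zl2 : \forall n \near \oo, real_norm (l - z n) < r / 2 by exact: zl.
have [n [/= ln en]] :=
  filter_ex (filterI zl2 (near_infty_natSinv_expn_lt (PosNum r2))).
apply: filterS (xF n) => u /= xu.
rewrite -(subrK (x n) (quotient_map l)) -addrA (le_lt_trans (ler_normD _ _))//.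
rewrite (splitr r) scalar_of_realD ltrD//.
  by rewrite -zx -quotient_mapB (le_lt_trans (quotient_map_norm_le _))// -real_norm_lt.
by rewrite (lt_trans xu)// ltr_scalar_of_real.
Qed.

HB.instance Definition _ :=
  Uniform_isComplete.Build quotient_space quotient_complete.

Lemma real_norm_quotient_map x : real_norm (quotient_map x) = subspace_dist x.
Proof. by rewrite /real_norm quotient_normE scalar_of_realK. Qed.

Lemma quotient_map_bounded : bounded_operator quotient_map.
Proof.
apply/bounded_operatorP; split; first exact: quotient_map_linear.
exists 1 => // x; rewrite mul1r real_norm_quotient_map -{2}(subr0 x).
exact: subspace_dist_le (rpred0 _).
Qed.

(** An infimum below [r] is beaten by some [n] in [N], and subtracting [n] from the representative
    leaves its class unchanged. *)
Lemma quotient_map_metric : metric_surjection quotient_map.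
Proof.
split=> [|u r]; first exact: quotient_map_bounded.
rewrite -[u]quotient_reprK real_norm_quotient_map => /subspace_dist_lt[n Nn nr].
exists (quotient_repr u - n) => //; apply/quotient_map_eq.
by rewrite addrAC subrr sub0r subspace_distN subspace_dist0.
Qed.

End QuotientSeminorm.

(** * Products of two Banach spaces *)

Section ProductSpace.
Variables (R : realType) (k : scalar_kind) (X Y : banachType R k).

(** The norm is the maximum norm, for which projections and inclusions are contractions; they cost
    nothing in gauge estimates. *)
Definition prod_space : Type := (X * Y)%type.

HB.instance Definition _ := NormedModule.copy prod_space (X * Y)%type.

Lemma prod_space_complete (F : set_system prod_space) :
  ProperFilter F -> cauchy F -> cvg F.
Proof.
move=> FF /cauchyP cF.
have coord (Z : banachType R k) (p : prod_space -> Z) :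
    (forall u v, `|p u - p v| <= `|u - v|) -> cvg (p @ F).
  move=> pn; apply: (@cauchy_cvg Z); apply/cauchyP => e e0.
  have [u Fu] := cF _ e0; exists (p u).
  have : F [set v | `|p u - p v| < e]; last by rewrite -ball_normE.
  apply: filterS Fu => v; rewrite -ball_normE /=; exact: le_lt_trans.
have /cvg_ex[a /cvgrPdist_lt Fa] : cvg (fst @ F).
  by apply: coord => u v; rewrite prod_normE /= num_le_max lexx.
have /cvg_ex[b /cvgrPdist_lt Fb] : cvg (snd @ F).
  by apply: coord => u v; rewrite prod_normE /= num_le_max lexx orbT.
apply/cvg_ex; exists (a, b); apply/cvgrPdist_lt => e e0.
apply: filterS (filterI (Fa _ e0) (Fb _ e0)) => u /= [ua ub].
by rewrite prod_normE /= num_gt_max ua.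
Qed.

HB.instance Definition _ := Uniform_isComplete.Build prod_space prod_space_complete.

Lemma prod_space_normE (u : prod_space) :
  real_norm u = Num.max (real_norm u.1) (real_norm u.2).
Proof.
apply/eqP; rewrite eq_le ge_max !real_norm_le prod_normE num_ge_max.
rewrite -!real_norm_le !le_max !lexx orbT /= !real_norm_le scalar_of_real_normE.
by rewrite prod_normE !num_le_max !lexx orbT.
Qed.

Definition prod_fst (u : prod_space) : X := u.1.
Definition prod_snd (u : prod_space) : Y := u.2.
Definition prod_inl (x : X) : prod_space := (x, 0).
Definition prod_inr (y : Y) : prod_space := (0, y).

Lemma prod_fst_contraction : bounded_operator prod_fst /\ operator_norm prod_fst <= 1.
Proof. by apply: contraction_bounded => // u; rewrite prod_space_normE le_max lexx. Qed.

Lemma prod_snd_contraction : bounded_operator prod_snd /\ operator_norm prod_snd <= 1.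
Proof.
by apply: contraction_bounded => // u; rewrite prod_space_normE le_max lexx orbT.
Qed.

Lemma prod_inl_contraction : bounded_operator prod_inl /\ operator_norm prod_inl <= 1.
Proof.
apply: contraction_bounded => [a x y|x].
  by rewrite /prod_inl; congr pair; rewrite /= scaler0 addr0.
by rewrite prod_space_normE /= real_norm0 ge_max lexx real_norm_ge0.
Qed.

Lemma prod_inr_contraction : bounded_operator prod_inr /\ operator_norm prod_inr <= 1.
Proof.
apply: contraction_bounded => [a x y|x].
  by rewrite /prod_inr; congr pair; rewrite /= scaler0 addr0.
by rewrite prod_space_normE /= real_norm0 ge_max lexx real_norm_ge0.
Qed.

End ProductSpace.

(** * Operator ideals and their composition *)

Section IdealTheory.
Variables (R : realType) (k : scalar_kind).
Variables (A : operator_class R k) (alpha : operator_gauge R k).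
Hypothesis idA : quasi_normed_operator_ideal A alpha.
Implicit Types X Y Z : banachType R k.
Local Notation K := (scalars R k).

Lemma ideal_compl X Y Z (T : X -> Y) (U : Y -> Z) :
  A T -> bounded_operator U -> A (U \o T).
Proof. by move=> AT bU; exact: (ideal_comp idA (bounded_operator_id X) AT bU). Qed.

Lemma ideal_compr X Y Z (V : X -> Y) (T : Y -> Z) :
  bounded_operator V -> A T -> A (T \o V).
Proof. by move=> bV AT; exact: (ideal_comp idA bV AT (bounded_operator_id Z)). Qed.

Lemma gauge_compl X Y Z (T : X -> Y) (U : Y -> Z) : A T -> bounded_operator U ->
  alpha (U \o T) <= operator_norm U * alpha T.
Proof.
move=> AT bU; apply: le_trans (gauge_comp idA (bounded_operator_id X) AT bU) _.
rewrite ler_piMr ?operator_norm_id// mulr_ge0 ?operator_norm_ge0//.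
exact: (gauge_ge0 idA AT).
Qed.

Lemma gauge_compr X Y Z (V : X -> Y) (T : Y -> Z) : bounded_operator V -> A T ->
  alpha (T \o V) <= alpha T * operator_norm V.
Proof.
move=> bV AT; apply: le_trans (gauge_comp idA bV AT (bounded_operator_id Z)) _.
rewrite ler_wpM2r ?operator_norm_ge0// ler_piMl ?operator_norm_id//.
exact: (gauge_ge0 idA AT).
Qed.

Lemma ideal_scale X Y (T : X -> Y) (c : K) : A T -> A (fun x => c *: T x).
Proof.
by move=> AT; exact: (ideal_compl AT (bounded_operator_scale c (bounded_operator_id Y))).
Qed.

(** The canonical surjection factors as [Q \o L], so [T] composed with it is [(T \o Q) \o L], which
    is in [A] by the ideal property. *)
Lemma surjective_descent X Y Z (Q : Z -> X) (T : X -> Y) :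
  surjective_hull A = A -> metric_surjection Q -> bounded_operator T ->
  A (T \o Q) -> A T.
Proof.
move=> hull mQ bT ATQ; have [L bL QL] := canonical_surjection_factor mQ.
rewrite -hull; split => //; rewrite -QL.
exact: (ideal_compr bL ATQ).
Qed.

End IdealTheory.

(** * The composition ideal and its gauge *)

Section Composition.
Variables (R : realType) (k : scalar_kind).
Variables (A1 A2 : operator_class R k) (alpha1 alpha2 : operator_gauge R k).
Hypothesis id1 : quasi_normed_operator_ideal A1 alpha1.
Hypothesis id2 : quasi_normed_operator_ideal A2 alpha2.
Implicit Types X Y Z : banachType R k.
Local Notation K := (scalars R k).
Local Notation re := (@scalar_re R k).
Local Notation ofR := (@scalar_of_real R k).
Local Notation A := (ideal_composition A1 A2).
Local Notation gauge := (composition_gauge A1 A2 alpha1 alpha2).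

Lemma composition_gauge_le X Z Y (V : X -> Z) (U : Z -> Y) :
  A2 V -> A1 U -> gauge (U \o V) <= alpha1 U * alpha2 V.
Proof.
move=> AV AU; apply: ge_inf; last by exists Z, V, U.
exists 0 => _ [Z' [V' [U' [AV' AU' _ ->]]]].
by rewrite mulr_ge0 ?(gauge_ge0 id1 AU') ?(gauge_ge0 id2 AV').
Qed.

(** Membership of [T] makes the set under the infimum nonempty; on the empty set [inf] is only a
    default value. *)
Lemma composition_gauge_ge X Y (T : X -> Y) (c : R) : A T ->
  (forall Z (V : X -> Z) (U : Z -> Y), A2 V -> A1 U -> T = U \o V ->
    c <= alpha1 U * alpha2 V) ->
  c <= gauge T.
Proof.
move=> [Z [V [U [AV AU ->]]]] cle; apply: lb_le_inf.
  by exists (alpha1 U * alpha2 V), Z, V, U.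
by move=> _ [Z' [V' [U' [AV' AU' TE ->]]]]; exact: cle.
Qed.

Lemma composition_bounded X Y (T : X -> Y) : A T -> bounded_operator T.
Proof.
move=> [Z [V [U [AV AU ->]]]].
exact: bounded_operator_comp (ideal_bounded id2 AV) (ideal_bounded id1 AU).
Qed.

(** Every admissible product dominates the product of the operator norms. Nonnegativity and
    definiteness of the gauge rest on this. *)
Lemma composition_gauge_norm X Y (T : X -> Y) : A T -> operator_norm T <= gauge T.
Proof.
move=> AT; apply: (composition_gauge_ge AT) => Z V U AV AU ->.
have bV := ideal_bounded id2 AV; have bU := ideal_bounded id1 AU.
rewrite (le_trans (operator_norm_comp bV bU))// ler_pM ?operator_norm_ge0//.
  exact: (gauge_norm id1 AU).
exact: (gauge_norm id2 AV).
Qed.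

Lemma composition_gauge_ge0 X Y (T : X -> Y) : A T -> 0 <= gauge T.
Proof.
move=> AT; apply: le_trans (composition_gauge_norm AT).
exact: operator_norm_ge0 (composition_bounded AT).
Qed.

Lemma composition_comp X0 X Y Y0 (V : X0 -> X) (T : X -> Y) (U : Y -> Y0) :
  bounded_operator V -> A T -> bounded_operator U -> A (U \o T \o V).
Proof.
move=> bV [Z [V' [U' [AV AU ->]]]] bU; exists Z, (V' \o V), (U \o U'); split => //.
  exact: (ideal_compr id2 bV AV).
exact: (ideal_compl id1 AU bU).
Qed.

Lemma composition_gauge_comp X0 X Y Y0 (V : X0 -> X) (T : X -> Y) (U : Y -> Y0) :
  bounded_operator V -> A T -> bounded_operator U ->
  gauge (U \o T \o V) <= operator_norm U * gauge T * operator_norm V.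
Proof.
move=> bV AT bU.
have U0 := operator_norm_ge0 bU; have V0 := operator_norm_ge0 bV.
have step Z (V' : X -> Z) (U' : Z -> Y) : A2 V' -> A1 U' -> T = U' \o V' ->
    gauge (U \o T \o V) <= operator_norm U * operator_norm V * (alpha1 U' * alpha2 V').
  move=> AV AU ->.
  have -> : U \o (U' \o V') \o V = (U \o U') \o (V' \o V) by [].
  apply: le_trans (composition_gauge_le (ideal_compr id2 bV AV)
    (ideal_compl id1 AU bU)) _.
  have := ler_pM (gauge_ge0 id1 (ideal_compl id1 AU bU))
    (gauge_ge0 id2 (ideal_compr id2 bV AV))
    (gauge_compl id1 AU bU) (gauge_compr id2 bV AV).
  by move=> /le_trans; apply; rewrite [alpha2 V' * _]mulrC mulrACA.
(* The infimum is reached by dividing by the product of the two norms. If that product is zero, a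
   single factorization already gives the bound 0. *)
rewrite mulrAC; move: (mulr_ge0 U0 V0); rewrite le_eqVlt => /predU1P[UV|UV].
  rewrite -UV mul0r; case: AT => Z [V' [U' [AV AU TE]]].
  by have := step Z V' U' AV AU TE; rewrite -UV mul0r.
rewrite -ler_pdivrMl//; apply: (composition_gauge_ge AT) => Z V' U' AV AU TE.
by rewrite ler_pdivrMl//; exact: step.
Qed.

Lemma composition_scale X Y (T : X -> Y) (c : K) : A T -> A (fun x => c *: T x).
Proof.
move=> AT; exact: (composition_comp (bounded_operator_id X) AT
  (bounded_operator_scale c (bounded_operator_id Y))).
Qed.

Lemma composition_gauge_scale_le X Y (T : X -> Y) (c : K) : A T ->
  gauge (fun x => c *: T x) <= re `|c| * gauge T.
Proof.
move=> AT; have bc := bounded_operator_scale c (bounded_operator_id Y).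
have c0 : 0 <= re `|c| by exact: scalar_re_ge0.
apply: le_trans (composition_gauge_comp (bounded_operator_id X) AT bc) _.
have g0 := composition_gauge_ge0 AT.
apply: le_trans (ler_piMr _ (operator_norm_id X)) _.
  by rewrite mulr_ge0 ?operator_norm_ge0.
rewrite ler_wpM2r//; apply: operator_norm_le => // y.
by rewrite real_normZ.
Qed.

Lemma composition_gauge_scale X Y (T : X -> Y) (c : K) : A T ->
  gauge (fun x => c *: T x) = re `|c| * gauge T.
Proof.
move=> AT; apply/eqP; rewrite eq_le composition_gauge_scale_le//=.
have AcT := composition_scale c AT.
have [c0|c0] := eqVneq c 0.
  rewrite [in leLHS]c0 normr0 -(scalar_of_real0 R k) scalar_of_realK mul0r.
  exact: composition_gauge_ge0.
have rc := scalar_re_norm_gt0 c0.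
(* The converse inequality is the first one for [c^-1] and the operator [c *: T x]. *)
have := composition_gauge_scale_le c^-1 AcT.
have -> : (fun x => c^-1 *: (c *: T x)) = T by apply/funext => x; rewrite scalerK.
move=> /(ler_wpM2l (ltW rc))/le_trans; apply.
by rewrite mulrA scalar_re_normV// mul1r.
Qed.

(** The weight is moved from [U] to [V]. Without this, the estimate for a sum would contain cross
    terms [alpha1 U1 * alpha2 V2], which the gauges of the summands do not control. *)
Lemma composition_normalize X Z Y (V : X -> Z) (U : Z -> Y) : A2 V -> A1 U ->
  exists (V' : X -> Z) (U' : Z -> Y), [/\ A2 V', A1 U', U' \o V' = U \o V,
    alpha1 U' <= 1 & alpha2 V' <= alpha1 U * alpha2 V].
Proof.
move=> AV AU; have := gauge_ge0 id1 AU; rewrite le_eqVlt => /predU1P[a0|a0].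
  (* A vanishing gauge means [U] is zero, so rescaling is impossible, but [V] can be replaced by
     zero. *)
  exists (fun x => 0 *: V x), U; split => //.
  - exact: (ideal_scale id2).
  - by apply/funext => x /=; rewrite !(gauge_eq0 id1 AU).
  - by rewrite -a0.
  - rewrite (gauge_scale id2 _ AV) -a0 mul0r normr0.
    by rewrite -(scalar_of_real0 R k) scalar_of_realK mul0r.
exists (fun x => ofR (alpha1 U) *: V x), (fun z => ofR (alpha1 U)^-1 *: U z).
have i0 : 0 <= (alpha1 U)^-1 by rewrite invr_ge0 ltW.
split.
- exact: (ideal_scale id2).
- exact: (ideal_scale id1).
- apply/funext => x /=; have [lU _] := ideal_bounded id1 AU.
  rewrite (linear_predZ lU) scalerA -scalar_of_realM mulVf ?gt_eqF//.
  by rewrite scalar_of_real1 scale1r.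
- rewrite (gauge_scale id1 _ AU) norm_scalar_of_real// scalar_of_realK.
  by rewrite mulVf// gt_eqF.
- by rewrite (gauge_scale id2 _ AV) norm_scalar_of_real ?(ltW a0)// scalar_of_realK.
Qed.

Section Sum.
Variables (X Y Z1 Z2 : banachType R k).
Variables (V1 : X -> Z1) (U1 : Z1 -> Y) (V2 : X -> Z2) (U2 : Z2 -> Y).
Hypotheses (AV1 : A2 V1) (AU1 : A1 U1) (AV2 : A2 V2) (AU2 : A1 U2).

(** [V] is the pair of [V1] and [V2], and [U] adds [U1] and [U2] of the coordinates. Both are
    written as sums of composites so that the ideal axioms apply directly. *)
Let V : X -> prod_space Z1 Z2 :=
  (@prod_inl _ _ Z1 Z2 \o V1) \+ (@prod_inr _ _ Z1 Z2 \o V2).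
Let U : prod_space Z1 Z2 -> Y :=
  (U1 \o @prod_fst _ _ Z1 Z2) \+ (U2 \o @prod_snd _ _ Z1 Z2).

Let AV1' : A2 (@prod_inl _ _ Z1 Z2 \o V1).
Proof. exact: (ideal_compl id2 AV1 (prod_inl_contraction _ _).1). Qed.

Let AV2' : A2 (@prod_inr _ _ Z1 Z2 \o V2).
Proof. exact: (ideal_compl id2 AV2 (prod_inr_contraction _ _).1). Qed.

Let AU1' : A1 (U1 \o @prod_fst _ _ Z1 Z2).
Proof. exact: (ideal_compr id1 (prod_fst_contraction _ _).1 AU1). Qed.

Let AU2' : A1 (U2 \o @prod_snd _ _ Z1 Z2).
Proof. exact: (ideal_compr id1 (prod_snd_contraction _ _).1 AU2). Qed.

Lemma composition_sum_factor : (U1 \o V1) \+ (U2 \o V2) = U \o V.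
Proof.
apply/funext => x; rewrite /U /V /= /prod_fst /prod_snd /prod_inl /prod_inr /=.
by rewrite addr0 add0r.
Qed.

Lemma composition_sum : A ((U1 \o V1) \+ (U2 \o V2)).
Proof.
exists (prod_space Z1 Z2), V, U; split; last exact: composition_sum_factor.
  exact: (ideal_add id2).
exact: (ideal_add id1).
Qed.

Lemma composition_gauge_sum (k1 k2 : R) : 0 <= k1 -> 0 <= k2 ->
  (forall S T : prod_space Z1 Z2 -> Y, A1 S -> A1 T ->
    alpha1 (S \+ T) <= k1 * (alpha1 S + alpha1 T)) ->
  (forall S T : X -> prod_space Z1 Z2, A2 S -> A2 T ->
    alpha2 (S \+ T) <= k2 * (alpha2 S + alpha2 T)) ->
  gauge ((U1 \o V1) \+ (U2 \o V2)) <=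
    k1 * (alpha1 U1 + alpha1 U2) * (k2 * (alpha2 V1 + alpha2 V2)).
Proof.
move=> k1_ge0 k2_ge0 add1 add2; rewrite composition_sum_factor.
have AU : A1 U by exact: (ideal_add id1).
have AV : A2 V by exact: (ideal_add id2).
apply: le_trans (composition_gauge_le AV AU) _.
apply: ler_pM; rewrite ?(gauge_ge0 id1 AU) ?(gauge_ge0 id2 AV)//.
  apply: le_trans (add1 _ _ AU1' AU2') _; rewrite ler_wpM2l// lerD//.
    apply: le_trans (gauge_compr id1 (prod_fst_contraction _ _).1 AU1) _.
    by rewrite ler_piMr ?(prod_fst_contraction _ _).2// (gauge_ge0 id1 AU1).
  apply: le_trans (gauge_compr id1 (prod_snd_contraction _ _).1 AU2) _.
  by rewrite ler_piMr ?(prod_snd_contraction _ _).2// (gauge_ge0 id1 AU2).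
apply: le_trans (add2 _ _ AV1' AV2') _; rewrite ler_wpM2l// lerD//.
  apply: le_trans (gauge_compl id2 AV1 (prod_inl_contraction _ _).1) _.
  by rewrite ler_piMl ?(prod_inl_contraction _ _).2// (gauge_ge0 id2 AV1).
apply: le_trans (gauge_compl id2 AV2 (prod_inr_contraction _ _).1) _.
by rewrite ler_piMl ?(prod_inr_contraction _ _).2// (gauge_ge0 id2 AV2).
Qed.

End Sum.

Lemma composition_add X Y (S T : X -> Y) : A S -> A T -> A (S \+ T).
Proof.
move=> [Z1 [V1 [U1 [AV1 AU1 ->]]]] [Z2 [V2 [U2 [AV2 AU2 ->]]]].
exact: composition_sum.
Qed.

Lemma composition_gauge_add : exists2 kappa : R, 1 <= kappa &
  forall X Y (S T : X -> Y), A S -> A T ->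
    gauge (S \+ T) <= kappa * (gauge S + gauge T).
Proof.
have [k1 k1_ge1 add1] := gauge_add id1; have [k2 k2_ge1 add2] := gauge_add id2.
have k1_gt0 := lt_le_trans ltr01 k1_ge1; have k2_gt0 := lt_le_trans ltr01 k2_ge1.
have kk_ge1 : 1 <= k1 * 2 * k2 by rewrite !mulr_ege1// ler1n.
have kk_gt0 := lt_le_trans ltr01 kk_ge1.
(* The factor 2 bounds the sum of the two normalized gauges [alpha1]. *)
exists (k1 * 2 * k2) => // X Y S T AS AT.
(* Each gauge is isolated on the right in turn, so that the two infima are taken one after the
   other. *)
rewrite -ler_pdivrMl// -lerBlDr; apply: (composition_gauge_ge AS).
move=> Z1 V1 U1 AV1 AU1 SE; rewrite lerBlDr addrC -lerBlDr.
apply: (composition_gauge_ge AT) => Z2 V2 U2 AV2 AU2 TE.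
rewrite lerBlDr ler_pdivrMl// SE TE.
have [V1' [U1' [AV1' AU1' <- U1_le V1_le]]] := composition_normalize AV1 AU1.
have [V2' [U2' [AV2' AU2' <- U2_le V2_le]]] := composition_normalize AV2 AU2.
apply: le_trans (composition_gauge_sum AV1' AU1' AV2' AU2' (ltW k1_gt0) (ltW k2_gt0)
  (add1 _ _) (add2 _ _)) _.
rewrite -[leRHS]mulrA; apply: ler_pM.
- by rewrite mulr_ge0 ?addr_ge0 ?(gauge_ge0 id1 AU1') ?(gauge_ge0 id1 AU2')// ltW.
- by rewrite mulr_ge0 ?addr_ge0 ?(gauge_ge0 id2 AV1') ?(gauge_ge0 id2 AV2')// ltW.
- by rewrite ler_wpM2l ?(ltW k1_gt0)// (_ : 2 = 1 + 1)// lerD.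
- by rewrite ler_wpM2l ?(ltW k2_gt0)// addrC lerD.
Qed.

Lemma composition_quasi_normed_operator_ideal :
  quasi_normed_operator_ideal A gauge.
Proof.
have Aid : A (@idfun (scalar_line R k)).
  exists (scalar_line R k), idfun, idfun.
  by split=> //; [exact: (ideal_id id2)|exact: (ideal_id id1)].
split.
- exact: composition_bounded.
- exact: Aid.
- exact: composition_add.
- exact: composition_comp.
- exact: composition_gauge_ge0.
- move=> X Y T AT g0 x; apply: real_norm_eq0.
  have := operator_norm_ub (composition_bounded AT) x; move=> /le_trans; apply.
  by rewrite mulr_le0_ge0 ?real_norm_ge0// -g0 composition_gauge_norm.
- by move=> X Y T c AT; exact: composition_gauge_scale.
- exact: composition_gauge_add.
- apply/eqP; rewrite eq_le; apply/andP; split.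
    have := composition_gauge_le (ideal_id id2) (ideal_id id1).
    by rewrite (gauge_id id1) (gauge_id id2) mulr1.
  by rewrite -(operator_norm_scalar_line R k); exact: composition_gauge_norm.
- exact: composition_gauge_comp.
- exact: composition_gauge_norm.
Qed.

(** * Surjectivity of the composition ideal *)

Lemma composition_surjective_hull_sub X Y (T : X -> Y) :
  A T -> surjective_hull A T.
Proof.
move=> AT; split; first exact: composition_bounded.
exact: (composition_comp (canonical_surjection_bounded X) AT (bounded_operator_id Y)).
Qed.

(* With [T \o q = U \o V], the middle space is replaced by its quotient by the
   closure of the image under [V] of the kernel of [q]: this is the smallest change
   making [V] descend along [q], while [U] still descends to the quotient. *)
Lemma composition_surjective_hull_sup X Y (T : X -> Y) :
  surjective_hull A1 = A1 -> surjective_hull A2 = A2 ->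
  surjective_hull A T -> A T.
Proof.
move=> hull1 hull2 [bT [Z [V [U [AV AU TE]]]]].
have mq := canonical_surjection_metric X; have [lq _] := canonical_surjection_bounded X.
have [lT _] := bT.
have bV := ideal_bounded id2 AV; have bU := ideal_bounded id1 AU.
have [lV _] := bV; have [lU [C C0 UC]] := (bounded_operatorP U).1 bU.
pose N0 : {pred Z} :=
  fun z => `[< exists2 f, canonical_surjection f = 0 & V f = z >].
have N0_submod : submod_closed N0.
  split; first by apply/asboolP; exists 0; [exact: linear_pred0|exact: linear_pred0].
  move=> a u v /asboolP[f qf Vf] /asboolP[g qg Vg]; apply/asboolP.
  by exists (a *: f + g); rewrite ?lq ?lV ?qf ?qg ?Vf ?Vg// scaler0 addr0.
pose N0_mixin := GRing.isSubmodClosed.Build K Z N0 N0_submod.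
pose N : submodClosed Z := HB.pack N0 N0_mixin.
pose Q : Z -> quotient_space N := quotient_map N.
have mQ : metric_surjection Q := quotient_map_metric N.
have Q0 z : Q z = 0 <-> subspace_dist N z = 0.
  by rewrite -{2}(subr0 z) -quotient_map_eq (linear_pred0 (quotient_map_linear N)).
have [V0 bV0 V0E] : exists2 V0 : X -> quotient_space N,
    bounded_operator V0 & V0 \o canonical_surjection (X := X) = Q \o V.
  apply: (metric_surjection_descend mq (bounded_operator_comp bV mQ.1)) => f qf /=.
  by apply/Q0/subspace_dist0/asboolP; exists f.
have [U0 bU0 U0E] : exists2 U0 : quotient_space N -> Y,
    bounded_operator U0 & U0 \o Q = U.
  apply: (metric_surjection_descend mQ bU) => z /Q0 z0.
  (* On [N] the operator [U] vanishes, as [U (V f)] is [T] of [canonical_surjection f], that is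
     [T 0]. A point [z] of the closure is approximated from [N] within [e / (C + 1)], whence [U z]
     has norm at most [e]. *)
  apply: real_norm_eq0; apply/ler_addgt0Pr => e e0; rewrite add0r.
  have C1 : 0 < C + 1 by rewrite ltr_pwDr.
  have [|n /asboolP[f qf Vf] zn] := @subspace_dist_lt _ _ _ N z (e / (C + 1)).
    by rewrite z0 divr_gt0.
  have Un : U n = 0.
    by rewrite -Vf; have := congr1 (@^~ f) TE; rewrite /= qf (linear_pred0 lT).
  have -> : U z = U (z - n) by rewrite (linear_predB lU) Un subr0.
  rewrite (le_trans (UC _))// (le_trans (ler_wpM2l C0 (ltW zn)))//.
  exact: ler_mul_div_succ.
exists (quotient_space N), V0, U0; split.
- apply: (surjective_descent id2 hull2 mq bV0); rewrite V0E.
  exact: (ideal_compl id2 AV mQ.1).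
- by apply: (surjective_descent id1 hull1 mQ bU0); rewrite U0E.
(* The factorization is checked on images of the canonical surjection, which exhaust [X]. *)
- apply/funext => x; have [f <- _] := canonical_surjection_lift x.
  have -> : T (canonical_surjection f) = U (V f) := congr1 (@^~ f) TE.
  rewrite -U0E /=; congr U0.
  exact/esym/(congr1 (@^~ f) V0E).
Qed.

End Composition.

Theorem theorem3p6 (R : realType) (k : scalar_kind)
    (A1 A2 : operator_class R k) (alpha1 alpha2 : operator_gauge R k)
    (hA1 : surjective_operator_ideal A1 alpha1)
    (hA2 : surjective_operator_ideal A2 alpha2) :
  surjective_operator_ideal (ideal_composition A1 A2)
    (composition_gauge A1 A2 alpha1 alpha2).
Proof.
have [[id1 hull1] [id2 hull2]] := (hA1, hA2).
split; first exact: composition_quasi_normed_operator_ideal.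
apply/functional_extensionality_dep => X; apply/functional_extensionality_dep => Y.
apply/seteqP; split=> T.
  exact: (composition_surjective_hull_sup id1 id2).
exact: (composition_surjective_hull_sub id1 id2).
Qed.
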